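(* Let $L_0$ be a logic, $L$ an extension of $L_0$, and $F\dashv G$ the associated Galois connection. Let $T_0$ be a theory of $L_0$ and $T=F(T_0)$. If $T_0$ is Hilbert-Post complete (in $L_0$) and $T$ is Hilbert-Post complete with respect to $L_0$, then $T$ is Hilbert-Post complete (in $L$).
   Context: A logic consists of a language (a set of formulas) together with deduction rules. A theory of a logic is a set of formulas which is deductively closed: every formula derivable from it using the rules already belongs to it. Theories are ordered by inclusion. In a given logic, $T_{\max}$ denotes the maximal theory (all formulas); a theory $T$ is consistent if $T\neq T_{\max}$, and it is Hilbert-Post complete if it is consistent and every theory containing $T$ is equal either to $T$ or to $T_{\max}$. For theories $T,T'$, $T+T'$ denotes the theory generated by $T\cup T'$. $L$ is an extension of $L_0$: formulas of $L_0$ are formulas of $L$. For a theory $T_0$ of $L_0$, $F(T_0)$ is the theory of $L$ generated by $T_0$; for a theory $T$ of $L$, $G(T)$ is the theory of $L_0$ consisting of the theorems of $T$ that are formulas of $L_0$. $F$ and $G$ are monotone and $F(T_0)\subseteq T$ iff $T_0\subseteq G(T)$. A theory $T'$ of $L$ is $L_0$-derivable from a theory $T$ of $L$ if $T'=T+F(T'_0)$ for some theory $T'_0$ of $L_0$. A theory $T$ of $L$ is Hilbert-Post complete with respect to $L_0$ if it is consistent and every theory of $L$ containing $T$ is $L_0$-derivable from $T$. *)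

(* Defs.v *)
From mathcomp Require Import all_boot.
From mathcomp Require Import boolp classical_sets.

Set Implicit Arguments.
Unset Strict Implicit.
Unset Printing Implicit Defensive.

Local Open Scope classical_set_scope.

(* [rule P c] says that [c] may be deduced from the set of premises [P] by one
   application of a rule; [P] need not be finite. *)
Record logic := Logic {
  formula : Type;
  rule : set formula -> formula -> Prop }.

Inductive derivable (L : logic) (A : set (formula L)) : set (formula L) :=
| derivable_axiom c : A c -> derivable A c
| derivable_rule P c : rule P c -> P `<=` derivable A -> derivable A c.

Record theory (L : logic) := Theory {
  theorems :> set (formula L);
  theory_closed : derivable theorems `<=` theorems }.

Lemma theory_ext (L : logic) (T T' : theory L) :
  theorems T = theorems T' -> T = T'.
Proof.
case: T T' => [A hA] [B hB] /= AB; case: _ / AB in hB *.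
by rewrite (Prop_irrelevance hA hB).
Qed.

Lemma derivable_cut (L : logic) (A B : set (formula L)) :
  A `<=` derivable B -> derivable A `<=` derivable B.
Proof.
move=> AB c; elim=> [d /AB // | P d rPd _ IH].
by apply: derivable_rule rPd _ => p; apply: IH.
Qed.

Definition generated (L : logic) (A : set (formula L)) : theory L :=
  Theory (derivable_cut (@subset_refl _ (derivable A))).

Lemma generated_sub (L : logic) (A : set (formula L)) (T : theory L) :
  generated A `<=` T <-> A `<=` T.
Proof.
split=> [AT c Ac | AT c Ac]; first exact/AT/derivable_axiom.
by apply/theory_closed/(derivable_cut _ Ac) => d /AT; apply: derivable_axiom.
Qed.

Definition Tmax (L : logic) : theory L :=
  Theory (@subsetT _ (derivable [set: formula L])).

Definition theory_add (L : logic) (T T' : theory L) : theory L :=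
  generated (T `|` T').

Definition consistent (L : logic) (T : theory L) : Prop := T <> Tmax L.

Definition hilbert_post_complete (L : logic) (T : theory L) : Prop :=
  consistent T /\
  forall T' : theory L, T `<=` T' -> T' = T \/ T' = Tmax L.

(* The image in [L] of a rule of [L0] only has to be derivable in [L]; being
   itself a rule of [L] is a special case. This is what makes the restriction
   of a theory of [L] to the formulas of [L0] a theory of [L0]. *)
Record extension (L0 L : logic) := Extension {
  embed :> formula L0 -> formula L;
  embed_inj : injective embed;
  embed_rule : forall (P : set (formula L0)) (c : formula L0),
    rule P c -> derivable (embed @` P) (embed c) }.

Definition F (L0 L : logic) (E : extension L0 L) (T0 : theory L0) : theory L :=
  generated (E @` T0).

Lemma restriction_closed (L0 L : logic) (E : extension L0 L) (T : theory L) :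
  derivable (E @^-1` T) `<=` E @^-1` T.
Proof.
move=> c; elim=> [// | P d rPd _ IH].
apply/theory_closed/(derivable_cut _ (embed_rule E rPd)) => _ [p Pp <-].
exact/derivable_axiom/IH.
Qed.

Definition G (L0 L : logic) (E : extension L0 L) (T : theory L) : theory L0 :=
  Theory (@restriction_closed L0 L E T).

Lemma F_G_galois (L0 L : logic) (E : extension L0 L) (T0 : theory L0)
  (T : theory L) : F E T0 `<=` T <-> T0 `<=` G E T.
Proof.
split=> [/generated_sub FT c T0c | T0G]; first by apply: FT; exists c.
by apply/generated_sub => _ [c T0c <-]; apply: T0G.
Qed.

Definition derivable_from (L0 L : logic) (E : extension L0 L)
    (T T' : theory L) : Prop :=
  exists T0' : theory L0, T' = theory_add T (F E T0').

Definition hilbert_post_complete_wrt (L0 L : logic) (E : extension L0 L)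
    (T : theory L) : Prop :=
  consistent T /\
  forall T' : theory L, T `<=` T' -> derivable_from E T T'.

(* Main.v *)
(** If [T'] contains [T = F T0], then [G T'] contains [T0], hence equals [T0]
    or [Tmax]. Write [T' = T + F T0'] with [T0'] included in [G T']. In the
    first case [F T0'] is included in [T], so [T' = T]. In the second case note
    that [F] need not preserve [Tmax]; but [Tmax] itself contains [T], so
    [Tmax = T + F T0''], and [T0''] included in [G T' = Tmax] gives
    [Tmax] included in [T']. *)
Require Import Defs.
From mathcomp Require Import all_boot.
From mathcomp Require Import boolp classical_sets.

Local Open Scope classical_set_scope.

Lemma theory_anti (L : logic) (T T' : theory L) :
  T `<=` T' -> T' `<=` T -> T = T'.
Proof. by move=> TT' T'T; apply: theory_ext; apply/seteqP. Qed.

Lemma theory_add_sub (L : logic) (T1 T2 T : theory L) :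
  theory_add T1 T2 `<=` T <-> T1 `<=` T /\ T2 `<=` T.
Proof. by rewrite -subUset; apply: generated_sub. Qed.

Theorem theorem2p6 (L0 L : logic) (E : extension L0 L)
    (T0 : theory L0) (T : theory L) (hT : T = F E T0)
    (hT0 : hilbert_post_complete T0)
    (hTrel : hilbert_post_complete_wrt E T) :
  hilbert_post_complete T.
Proof.
case: hT0 => _ T0_complete; case: hTrel => T_consistent T_complete.
split=> // T' TT'.
have T0G : T0 `<=` G E T' by apply/F_G_galois; rewrite -hT.
case: (T0_complete _ T0G) => [GT' | GT']; [left | right].
- case: (T_complete _ TT') => T0' T'E.
  apply: theory_anti => //; rewrite T'E; apply/theory_add_sub; split=> //.
  (* [T'] contains its own summand [F E T0']; transposing across the adjunction puts [T0'] inside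
     [G E T'], which is [T0] here. *)
  have /theory_add_sub[_ /F_G_galois] : theory_add T (F E T0') `<=` T'.
    by rewrite -T'E.
  rewrite GT' => T0'T0; apply/F_G_galois; apply: subset_trans T0'T0 _.
  (* Unit of the adjunction at [T0]. *)
  by apply/F_G_galois; rewrite -hT.
(* Relative completeness is applied to [Tmax L] instead of [T']: whatever the witness [T0''] is, it
   lies in [G E T'], which contains every formula of [L0]. *)
- case: (T_complete (Tmax L)) => [//|T0'' TmaxE].
  apply: theory_anti => //; rewrite TmaxE; apply/theory_add_sub; split=> //.
  by apply/F_G_galois; rewrite GT'.
Qed.
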